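(* Let $R$ be a $2$-torsion free $\sigma$-prime ring, where $\sigma$ is an involution of $R$, let $U$ be a $\sigma$-square closed Lie ideal of $R$, and let $T$ be a ring automorphism of $R$, different from the identity map of $R$, which is centralizing on $U$. If $T$ commutes with $\sigma$ on $U$ (that is, $T(\sigma(u))=\sigma(T(u))$ for all $u\in U$), then $U\subset Z(R)$.
   Context: Rings are associative and not assumed to have an identity element. $Z(R)$ denotes the center of $R$, and $[x,y]=xy-yx$. $R$ is $2$-torsion free if $2x=0$ with $x\in R$ implies $x=0$. An involution $\sigma$ of $R$ is an additive map $\sigma:R\to R$ with $\sigma(xy)=\sigma(y)\sigma(x)$ and $\sigma(\sigma(x))=x$ for all $x,y\in R$. A ring $R$ with involution $\sigma$ is $\sigma$-prime if, for all $a,b\in R$, $aRb=aR\sigma(b)=0$ implies $a=0$ or $b=0$. A Lie ideal of $R$ is an additive subgroup $U$ of $R$ such that $[u,r]\in U$ for all $u\in U$, $r\in R$. A $\sigma$-Lie ideal is a Lie ideal $U$ with $\sigma(U)=U$. A $\sigma$-square closed Lie ideal is a $\sigma$-Lie ideal $U$ such that $u^2\in U$ for all $u\in U$. A map $T:R\to R$ is centralizing on a subset $S$ of $R$ if $[x,T(x)]\in Z(R)$ for every $x\in S$. *)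

(* Defs.v *)
From HB Require Import structures.
From mathcomp Require Import all_boot all_algebra.
From mathcomp Require Import boolp classical_sets.

Set Implicit Arguments.
Unset Strict Implicit.
Unset Printing Implicit Defensive.

Import GRing.Theory.

Local Open Scope classical_set_scope.
Local Open Scope ring_scope.

(* The rings of ssralg all have an identity; a possibly non-unital associative
   ring is a zmodType with an associative, biadditive product. *)
HB.mixin Record Zmodule_isRng R of GRing.Zmodule R := {
  rmul : R -> R -> R;
  rmulA : associative rmul;
  rmulDl : left_distributive rmul +%R;
  rmulDr : right_distributive rmul +%R
}.

#[short(type="rngType")]
HB.structure Definition Rng := {R of Zmodule_isRng R & GRing.Zmodule R}.

(* [*] stays reserved for the product of unital rings. *)
Notation "x ** y" := (rmul x y) (at level 40, left associativity) : ring_scope.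

Definition commutator (R : rngType) (x y : R) : R := x ** y - y ** x.

Section Definitions.
Variable R : rngType.
Implicit Types (sigma T : R -> R) (U S : set R).

Definition center : set R := [set z | forall r : R, z ** r = r ** z].

Definition torsion2_free : Prop := forall x : R, x *+ 2 = 0 -> x = 0.

Record is_involution sigma : Prop := {
  involutionD : {morph sigma : x y / x + y};
  involutionM : forall x y, sigma (x ** y) = sigma y ** sigma x;
  involutionK : involutive sigma
}.

Definition sigma_prime sigma : Prop :=
  forall a b : R,
    (forall r, a ** r ** b = 0) -> (forall r, a ** r ** sigma b = 0) ->
    a = 0 \/ b = 0.

Record is_lie_ideal U : Prop := {
  lie_ideal0 : U 0;
  lie_idealB : forall u v, U u -> U v -> U (u - v);
  lie_idealR : forall u r, U u -> U (commutator u r)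
}.

Record is_sigma_lie_ideal sigma U : Prop := {
  sigma_lie_ideal : is_lie_ideal U;
  sigma_lie_ideal_image : sigma @` U = U
}.

Record is_sigma_square_closed_lie_ideal sigma U : Prop := {
  sigma_square_closed : is_sigma_lie_ideal sigma U;
  square_closed : forall u, U u -> U (u ** u)
}.

Record is_ring_automorphism T : Prop := {
  automorphismD : {morph T : x y / x + y};
  automorphismM : {morph T : x y / x ** y};
  automorphism_bij : bijective T
}.

Definition centralizing_on T S : Prop :=
  forall x, S x -> center (commutator x (T x)).

End Definitions.

Arguments center R : clear implicits.
Arguments torsion2_free R : clear implicits.

(* Main.v *)
(* If U is not central, then U contains a nonzero sigma-stable ideal J, because
   2[u,v]r = 2[u,vr] - 2v[u,r] lies in U.  On J the map T is even commuting, so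
   (Tx - x) T(J) [x,T(J)] = 0 for x in J.  When sigma x = x or sigma x = -x the
   element Tx - x has the same symmetry, and sigma-primeness forces Tx = x or
   x central.  If all such x are fixed, then T fixes J and hence R.  If some such
   x is not fixed, then it is central, and comparing y with xy shows that every
   such y is central; then J, and hence R, is commutative. *)
Require Import Defs.
From mathcomp Require Import all_boot all_algebra.
From mathcomp Require Import boolp classical_sets.

Set Implicit Arguments.
Unset Strict Implicit.

Import GRing.Theory.

Local Open Scope classical_set_scope.
Local Open Scope ring_scope.

(** * Commutator calculus in rings without identity *)

Section RngTheory.
Variable R : rngType.
Implicit Types x y z r : R.

Lemma rmul0l x : 0 ** x = 0.
Proof. by apply: (addrI (0 ** x)); rewrite -rmulDl !addr0. Qed.

Lemma rmul0r x : x ** 0 = 0.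
Proof. by apply: (addrI (x ** 0)); rewrite -rmulDr !addr0. Qed.

Lemma rmulNl x y : (- x) ** y = - (x ** y).
Proof. by apply: (addrI (x ** y)); rewrite -rmulDl !subrr rmul0l. Qed.

Lemma rmulNr x y : x ** (- y) = - (x ** y).
Proof. by apply: (addrI (x ** y)); rewrite -rmulDr !subrr rmul0r. Qed.

Lemma rmulBl x y z : (x - y) ** z = x ** z - y ** z.
Proof. by rewrite rmulDl rmulNl. Qed.

Lemma rmulBr x y z : x ** (y - z) = x ** y - x ** z.
Proof. by rewrite rmulDr rmulNr. Qed.

Lemma commutatorN x y : - commutator x y = commutator y x.
Proof. exact: opprB. Qed.

Lemma commutatorxx x : commutator x x = 0.
Proof. exact: subrr. Qed.

Lemma commutatorDl x y z :
  commutator (x + y) z = commutator x z + commutator y z.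
Proof. by rewrite /commutator rmulDl rmulDr opprD addrACA. Qed.

Lemma commutatorDr x y z :
  commutator x (y + z) = commutator x y + commutator x z.
Proof. by rewrite /commutator rmulDl rmulDr opprD addrACA. Qed.

Lemma commutatorMr x y z :
  commutator x (y ** z) = commutator x y ** z + y ** commutator x z.
Proof. by rewrite /commutator rmulBl rmulBr !rmulA addrA subrK. Qed.

Lemma commutatorMl x y z :
  commutator (x ** y) z = x ** commutator y z + commutator x z ** y.
Proof. by rewrite /commutator rmulBl rmulBr !rmulA addrA subrK. Qed.

Lemma centerP x : center R x <-> forall r, commutator x r = 0.
Proof.
split=> [cx r|cx r]; first by rewrite /commutator cx subrr.
by apply/eqP; rewrite -subr_eq0; apply/eqP; exact: cx.
Qed.

Lemma centerD x y : center R x -> center R y -> center R (x + y).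
Proof. by move=> cx cy r; rewrite rmulDl rmulDr cx cy. Qed.

Lemma centerN x : center R x -> center R (- x).
Proof. by move=> cx r; rewrite rmulNl rmulNr cx. Qed.

Lemma center_half x (tf : torsion2_free R) : center R (x + x) -> center R x.
Proof.
move=> /centerP c2x; apply/centerP => r.
by apply: tf; rewrite mulr2n -commutatorDl.
Qed.

Lemma commutator_center z x y :
  center R z -> commutator x (z ** y) = z ** commutator x y.
Proof.
by move=> cz; rewrite commutatorMr /(commutator x z) cz subrr rmul0l add0r.
Qed.

End RngTheory.

(** * Annihilators and ideals in $\sigma$-prime rings *)

Section SigmaPrime.
Variables (R : rngType) (sigma : R -> R).
Hypotheses (invol : is_involution sigma) (spr : sigma_prime sigma).
Implicit Types (a b x y r : R) (J : set R).

Lemma involution0 : sigma 0 = 0.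
Proof.
by apply: (addrI (sigma 0)); rewrite -(involutionD invol) !addr0.
Qed.

Lemma involutionN x : sigma (- x) = - sigma x.
Proof.
apply: (addrI (sigma x)).
by rewrite -(involutionD invol) !subrr involution0.
Qed.

Lemma involutionB x y : sigma (x - y) = sigma x - sigma y.
Proof. by rewrite (involutionD invol) involutionN. Qed.

(** Since $\sigma(a t \sigma(a)) = a \sigma(t) \sigma(a)$ again starts with $a$, $\sigma$-primeness
    applies to the pair $a$, $a t \sigma(a)$ and gives $a R \sigma(a) = 0$; it then applies to $a$,
    $a$. *)
Lemma sigma_prime_semiprime a : (forall r, a ** r ** a = 0) -> a = 0.
Proof.
move=> aRa.
have aRsa t : a ** t ** sigma a = 0.
  case: (@spr a (a ** t ** sigma a)) => // [r|r|->].
  - by rewrite !rmulA aRa !rmul0l.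
  - by rewrite !(involutionM invol) (involutionK invol) !rmulA aRa !rmul0l.
  - by rewrite !rmul0l.
by case: (@spr a a).
Qed.

Lemma annihilator_sym a b :
  (forall r, a ** r ** b = 0) -> forall r, b ** r ** a = 0.
Proof.
move=> aRb r; apply: sigma_prime_semiprime => s.
have -> : b ** r ** a ** s ** (b ** r ** a) = b ** r ** (a ** s ** b) ** r ** a.
  by rewrite !rmulA.
by rewrite aRb rmul0r !rmul0l.
Qed.

Definition hermitian_or_skew x : Prop := sigma x = x \/ sigma x = - x.

(** When $\sigma(a) = \pm a$ the two conditions of [sigma_prime] on the pair $b$, $a$ coincide, so
    such an $a$ behaves as in a prime ring. The sides are swapped because [sigma_prime] twists its
    second argument. *)
Lemma hermitian_or_skew_prime a b :
  hermitian_or_skew a -> (forall r, a ** r ** b = 0) -> a = 0 \/ b = 0.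
Proof.
move=> sa /annihilator_sym bRa.
have [||->|->] := @spr b a; [by [] | | by right | by left].
by move=> r; case: sa => ->; rewrite ?rmulNr bRa ?oppr0.
Qed.

Lemma central_hermitian_or_skew_regular a b :
  hermitian_or_skew a -> center R a -> a ** b = 0 -> a = 0 \/ b = 0.
Proof.
move=> sa ca ab0; apply: hermitian_or_skew_prime => // r.
by rewrite ca -rmulA ab0 rmul0r.
Qed.

Lemma central_cube_eq0 z : center R z -> z ** z ** z = 0 -> z = 0.
Proof.
move=> cz z3.
have z2 : z ** z = 0.
  apply: sigma_prime_semiprime => r.
  have -> : z ** z ** r ** (z ** z) = z ** r ** (z ** z ** z).
    by rewrite -[z ** z ** r]rmulA [z ** r in LHS]cz !rmulA.
  by rewrite z3 rmul0r.
by apply: sigma_prime_semiprime => r; rewrite cz -rmulA z2 rmul0r.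
Qed.

Record is_sigma_ideal J : Prop := {
  sigma_idealB : forall x y, J x -> J y -> J (x - y);
  sigma_ideal_mull : forall x r, J x -> J (r ** x);
  sigma_ideal_mulr : forall x r, J x -> J (x ** r);
  sigma_ideal_stable : forall x, J x -> J (sigma x)
}.

Lemma sigma_idealD J : is_sigma_ideal J ->
  forall x y, J x -> J y -> J (x + y).
Proof.
move=> JI x y Jx Jy; rewrite -[y]opprK; apply: sigma_idealB => //.
by rewrite -sub0r -(subrr y); apply: sigma_idealB => //; apply: sigma_idealB.
Qed.

(** From $yRb \subseteq Jb = 0$ follows $bRy = 0$ for all $y \in J$, in particular for $j$ and
    $\sigma(j)$. *)
Lemma sigma_ideal_regular J j b : is_sigma_ideal J -> J j -> j <> 0 ->
  (forall y, J y -> y ** b = 0) -> b = 0.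
Proof.
move=> JI Jj j0 Jb.
have ann y : J y -> forall r, b ** r ** y = 0.
  move=> Jy; apply: annihilator_sym => r; apply: Jb.
  exact: sigma_ideal_mulr.
by case: (@spr b j) => //; apply: ann => //; apply: sigma_ideal_stable.
Qed.

(** Expanding $[x,yr] = 0$ leaves $y[x,r] = 0$ for all $y \in J$. *)
Lemma sigma_ideal_centralizer J j x : is_sigma_ideal J -> J j -> j <> 0 ->
  (forall y, J y -> commutator x y = 0) -> center R x.
Proof.
move=> JI Jj j0 xJ; apply/centerP => r.
apply: (sigma_ideal_regular JI Jj j0) => // y Jy.
have := xJ _ (sigma_ideal_mulr JI r Jy).
by rewrite commutatorMr xJ // rmul0l add0r.
Qed.

(** The derivation $d = [u,\cdot]$ has $d^2 = 0$, so $0 = d^2(st) = 2d(s)d(t)$. Expanding $d(r)d(sr)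
    = 0$ then gives $d(r)\,s\,d(r) = 0$, and semiprimeness applies. *)
Lemma commutative_lie_ideal_central U : torsion2_free R -> is_lie_ideal U ->
  (forall u v, U u -> U v -> commutator u v = 0) -> U `<=` center R.
Proof.
move=> tf UL Ucomm u Uu; apply/centerP => r.
have uu s : commutator u (commutator u s) = 0.
  by apply: Ucomm => //; apply: lie_idealR.
have prod s t : commutator u s ** commutator u t = 0.
  have := uu (s ** t).
  rewrite commutatorMr commutatorDr !commutatorMr !uu rmul0l rmul0r add0r addr0.
  by rewrite -mulr2n => /tf.
apply: sigma_prime_semiprime => s.
by have := prod r (s ** r); rewrite commutatorMr rmulDr !rmulA prod rmul0l add0r.
Qed.

End SigmaPrime.

(** * The ideal inside a square closed Lie ideal *)

Section IdealCore.
Variables (R : rngType) (U : set R).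

(** For an additive subgroup [U] this is the largest two-sided ideal contained in [U]; without an
    identity the one-sided and two-sided multiples need separate conditions. *)
Definition ideal_core : set R :=
  [set x | [/\ U x, forall r, U (r ** x), forall r, U (x ** r) &
               forall r s, U (r ** x ** s)]].

Lemma ideal_core_sigma_ideal sigma : is_involution sigma ->
  is_sigma_lie_ideal sigma U -> is_sigma_ideal sigma ideal_core.
Proof.
move=> invol [UL Us].
have Ustable x : U x -> U (sigma x) by move=> Ux; rewrite -Us; exists x.
have sK := involutionK invol.
split=> [x y [x0 x1 x2 x3] [y0 y1 y2 y3]|x r [x0 x1 x2 x3]|x r [x0 x1 x2 x3]
        |x [x0 x1 x2 x3]].
- split=> [|r|r|r s]; rewrite ?rmulBr ?rmulBl; exact: lie_idealB.
- by split=> // [s|s t]; rewrite ?rmulA.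
- split=> [|s|s|s t] //; first by rewrite rmulA.
  + by rewrite -rmulA.
  + by rewrite rmulA -rmulA.
- split=> [|r|r|r s]; first exact: Ustable.
  + by rewrite -[r]sK -(involutionM invol); exact: Ustable.
  + by rewrite -[r]sK -(involutionM invol); exact: Ustable.
  + by rewrite -rmulA -[r]sK -[s]sK -!(involutionM invol); exact: Ustable.
Qed.

Hypotheses (UL : is_lie_ideal U) (Usq : forall u, U u -> U (u ** u)).

Lemma lie_idealD u v : U u -> U v -> U (u + v).
Proof.
move=> Uu Uv; rewrite -[v]opprK -[- v]sub0r; apply: lie_idealB => //.
by apply: lie_idealB => //; exact: lie_ideal0.
Qed.

(** Polarizing the square gives $uv + vu \in U$; adding $[u,v]$ turns it into $2uv$. *)
Lemma square_closed_double_mul u v : U u -> U v -> U (u ** v + u ** v).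
Proof.
move=> Uu Uv.
have -> : u ** v + u ** v =
    (u + v) ** (u + v) - u ** u - v ** v + commutator u v.
  rewrite /commutator rmulDl !rmulDr.
  rewrite -[u ** u + u ** v + _]addrA [u ** u + _]addrC addrK.
  by rewrite [u ** v + (_ + _)]addrA addrK addrACA subrr addr0.
apply: lie_idealD; last exact: lie_idealR.
apply: lie_idealB; [by []| |exact: Usq].
by apply: lie_idealB; [by []|apply/Usq/lie_idealD|exact: Usq].
Qed.

Lemma ideal_core_double_commutator u v r s : U u -> U v ->
  ideal_core (r ** (commutator u v + commutator u v) ** s).
Proof.
move=> Uu Uv; set c := commutator u v + commutator u v.
have cr t : U (c ** t).
  have -> : c ** t = commutator u (v ** t) + commutator u (v ** t)
     - (v ** commutator u t + v ** commutator u t).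
    by rewrite commutatorMr addrACA addrK rmulDl.
  apply: lie_idealB; [by []| |].
    by apply: lie_idealD; apply: lie_idealR.
  by apply: square_closed_double_mul => //; apply: lie_idealR.
(* A left factor moves to the right modulo a commutator with $cw \in U$. All four conditions for
   $rcs$ reduce to this one. *)
have rcr t w : U (t ** c ** w).
  have -> : t ** c ** w = c ** (w ** t) - commutator (c ** w) t.
    by rewrite /commutator !rmulA opprB addrC subrK.
  by apply: lie_idealB => //; apply: lie_idealR.
by split=> [|t|t|t w]; rewrite ?rmulA // -?[_ ** s ** _]rmulA // rmulA.
Qed.

End IdealCore.

(** * Centralizing and commuting automorphisms *)

Section Automorphism.
Variables (R : rngType) (sigma T : R -> R).
Hypotheses (tf : torsion2_free R) (invol : is_involution sigma).
Hypotheses (spr : sigma_prime sigma) (autT : is_ring_automorphism T).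
Implicit Types (x y r : R) (J : set R).

Let TD := automorphismD autT.
Let TM := automorphismM autT.

Lemma automorphism0 : T 0 = 0.
Proof. by apply: (addrI (T 0)); rewrite -TD !addr0. Qed.

Lemma automorphismN x : T (- x) = - T x.
Proof. by apply: (addrI (T x)); rewrite -TD !subrr automorphism0. Qed.

Lemma automorphism_surj y : exists x, T x = y.
Proof. by case: (automorphism_bij autT) => g _ gK; exists (g y). Qed.

Lemma automorphism_center x : center R x -> center R (T x).
Proof.
by move=> cx r; have [s <-] := automorphism_surj r; rewrite -!TM cx.
Qed.

Lemma automorphism_neq0 x : x <> 0 -> T x <> 0.
Proof.
move=> x0 Tx0; apply: x0; apply: (bij_inj (automorphism_bij autT)).
by rewrite automorphism0.
Qed.

(* With z = [x,Tx] central, [x^2,T(x^2)] = 2z(x Tx + Tx x); commuting this with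
   x and then with Tx gives z^3 = 0. *)
Lemma centralizing_commuting (S : set R) :
  (forall x, S x -> S (x ** x)) -> centralizing_on T S ->
  forall x, S x -> commutator x (T x) = 0.
Proof.
move=> Ssq centT x Sx.
have [z zE] : exists z, z = commutator x (T x) by eexists.
have cz : center R z by rewrite zE; exact: centT.
rewrite -zE; set w := z ** (x ** T x + T x ** x).
have cw : center R w.
  apply: center_half => //; have := centT _ (Ssq _ Sx).
  have xTxx : commutator x (T x ** T x) = z ** T x + z ** T x.
    by rewrite commutatorMr -zE -cz.
  rewrite TM commutatorMl xTxx rmulDr rmulDl !rmulA -(cz x) -!rmulA.
  by rewrite addrACA -rmulDr.
have xw : commutator x w = z ** z ** x + z ** z ** x.
  rewrite commutator_center // commutatorDr !commutatorMr commutatorxx.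
  by rewrite rmul0l rmul0r add0r addr0 -zE -cz -rmulA rmulDr.
have zzx : z ** z ** x = 0.
  by apply: tf; rewrite mulr2n -xw /commutator cw subrr.
apply: (central_cube_eq0 invol spr) => //.
have czz : center R (z ** z) by move=> r; rewrite -rmulA cz -rmulA cz rmulA.
have := commutatorMl (z ** z) x (T x).
rewrite zzx -zE (proj1 (centerP _) czz) rmul0l addr0 => <-.
by rewrite /commutator rmul0l rmul0r subrr.
Qed.

(** * Automorphisms on a nonzero $\sigma$-ideal *)

Section OnIdeal.
Variables (J : set R) (j : R).
Hypotheses (JI : is_sigma_ideal sigma J) (Jj : J j) (j_neq0 : j <> 0).
Hypotheses (commT : forall x, J x -> T (sigma x) = sigma (T x)).

(** For $y \in J$, $y(Tr - r) = T(yr) - yr = 0$. *)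
Lemma automorphism_fix_ideal : (forall x, J x -> T x = x) -> T =1 id.
Proof.
move=> TJ r; apply/eqP; rewrite -subr_eq0; apply/eqP.
apply: (sigma_ideal_regular invol spr JI Jj j_neq0) => // y Jy.
rewrite rmulBr -{1}(TJ y) // -TM TJ ?subrr //.
exact: (sigma_ideal_mulr JI).
Qed.

Lemma image_sigma_ideal : is_sigma_ideal sigma (T @` J).
Proof.
split=> [_ _ [x Jx <-] [y Jy <-]|_ r [x Jx <-]|_ r [x Jx <-]|_ [x Jx <-]].
- exists (x - y); first exact: (sigma_idealB JI).
  by rewrite TD automorphismN.
- have [s <-] := automorphism_surj r; exists (s ** x); last exact: TM.
  exact: (sigma_ideal_mull JI).
- have [s <-] := automorphism_surj r; exists (x ** s); last exact: TM.
  exact: (sigma_ideal_mulr JI).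
- exists (sigma x); last exact: commT.
  exact: (sigma_ideal_stable JI).
Qed.

Lemma hermitian_or_skew_displacement x : J x -> hermitian_or_skew sigma x ->
  hermitian_or_skew sigma (T x - x).
Proof.
move=> Jx sx; rewrite /hermitian_or_skew involutionB // -commT //.
by case: sx => ->; [left|right]; rewrite ?automorphismN ?opprB ?opprK 1?addrC.
Qed.

Hypothesis commutingT : forall x, J x -> commutator x (T x) = 0.

(** Linearization of $[x,Tx] = 0$ at $x+y$. *)
Lemma commuting_swap x y : J x -> J y ->
  commutator x (T y) = commutator (T x) y.
Proof.
move=> Jx Jy; apply/eqP; rewrite -subr_eq0 commutatorN; apply/eqP.
have := commutingT (sigma_idealD JI Jx Jy).
by rewrite TD commutatorDl !commutatorDr !commutingT // add0r addr0.
Qed.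

(** Putting $xy$ for $y$ in [commuting_swap] gives $Tx\,[x,Ty] = x[Tx,y] = x[x,Ty]$. *)
Lemma commuting_annihilator x y : J x -> J y ->
  (T x - x) ** commutator x (T y) = 0.
Proof.
move=> Jx Jy.
have := commuting_swap Jx (sigma_ideal_mull JI x Jy).
rewrite TM !commutatorMr commutingT // -(commutatorN x) commutingT //.
by rewrite oppr0 !rmul0l !add0r -commuting_swap // rmulBl => ->; rewrite subrr.
Qed.

Lemma commuting_fixed_or_central x : J x -> hermitian_or_skew sigma x ->
  T x = x \/ center R x.
Proof.
move=> Jx sx.
have sTx := hermitian_or_skew_displacement Jx sx.
(* Apply [commuting_annihilator] to $syw$ with $Ts = r$; the term containing $[x,T(sy)]$ vanishes by
   the same lemma. *)
have ann y w r : J y -> J w -> (T x - x) ** r ** (T y ** commutator x (T w)) = 0.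
  move=> Jy Jw; have [s <-] := automorphism_surj r.
  have Jsy : J (s ** y) by exact: (sigma_ideal_mull JI).
  have Jsyw : J (s ** y ** w) by exact: (sigma_ideal_mulr JI).
  have := commuting_annihilator Jx Jsyw.
  rewrite TM commutatorMr rmulDr rmulA commuting_annihilator //.
  by rewrite rmul0l add0r TM !rmulA.
have [->|/eqP Tx_neq] := eqVneq (T x) x; [by left | right].
have TJI := image_sigma_ideal.
have TJj : (T @` J) (T j) by exists j.
have Tj_neq0 := automorphism_neq0 j_neq0.
(* As $Tx - x \neq 0$, [ann] gives $T(J)[x,T(J)] = 0$. The ideal $T(J)$ is cancelled on the left,
   and then $x$ centralizes it. *)
apply: (sigma_ideal_centralizer invol spr TJI TJj Tj_neq0) => //.
move=> _ [w Jw <-].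
apply: (sigma_ideal_regular invol spr TJI TJj Tj_neq0) => //.
move=> _ [y Jy <-].
have [/eqP|//] := hermitian_or_skew_prime invol spr sTx
  (fun r => ann y w r Jy Jw).
by rewrite subr_eq0 => /eqP.
Qed.

Lemma commuting_hermitian_or_skew_central x : J x ->
  hermitian_or_skew sigma x -> T x <> x ->
  forall y, J y -> hermitian_or_skew sigma y -> center R y.
Proof.
move=> Jx sx Tx y Jy sy.
have [//|cx] := commuting_fixed_or_central Jx sx.
have [Ty|//] := commuting_fixed_or_central Jy sy.
have x_neq0 : x <> 0 by move=> x0; apply: Tx; rewrite x0 automorphism0.
have sxy : hermitian_or_skew sigma (x ** y).
  rewrite /hermitian_or_skew (involutionM invol) cx.
  case: sx => ->; case: sy => ->; rewrite ?rmulNl ?rmulNr ?opprK;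
    by [left|right].
have Jxy : J (x ** y) by exact: (sigma_ideal_mull JI).
(* If $xy$ were fixed as well as $y$, then $(Tx - x)y = 0$, and the nonzero central factor cancels,
   so $y = 0$. Otherwise $xy$ is central and $x[y,r] = 0$ with $x$ cancellable. *)
have [|cxy] := commuting_fixed_or_central Jxy sxy.
  rewrite TM Ty => /eqP; rewrite -subr_eq0 -rmulBl => /eqP Txy.
  have [| |/eqP|->] := central_hermitian_or_skew_regular invol spr _ _ Txy.
  - exact: hermitian_or_skew_displacement.
  - by apply: centerD; [apply: automorphism_center|apply: centerN].
  - by rewrite subr_eq0 => /eqP.
  - by move=> r; rewrite rmul0l rmul0r.
apply/centerP => r.
have xyr : x ** commutator y r = 0.
  by rewrite -commutatorN rmulNr -commutator_center // commutatorN;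
    move/centerP: cxy.
by case: (central_hermitian_or_skew_regular invol spr sx cx xyr).
Qed.

Lemma commuting_automorphism_commutative : ~ (T =1 id) ->
  forall r, center R r.
Proof.
move=> T_neq_id.
have sumP x : J x -> J (x + sigma x) /\ hermitian_or_skew sigma (x + sigma x).
  move=> Jx; split; first exact/(sigma_idealD JI)/(sigma_ideal_stable JI).
  by left; rewrite (involutionD invol) (involutionK invol) addrC.
have diffP x : J x -> J (x - sigma x) /\ hermitian_or_skew sigma (x - sigma x).
  move=> Jx; split; first exact/(sigma_idealB JI)/(sigma_ideal_stable JI).
  by right; rewrite (involutionB invol) (involutionK invol) opprB.
have doubleE x : x + x = (x + sigma x) + (x - sigma x).
  by rewrite addrACA subrr addr0.
(* If no such $x$ existed, both summands of $2x = (x+\sigma(x)) + (x-\sigma(x))$ would be fixed for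
   every $x \in J$, hence [T] would fix $J$ and all of $R$. *)
have [x [Jx sx Tx]] :
    exists x, [/\ J x, hermitian_or_skew sigma x & T x <> x].
  apply: contrapT => nex; apply: T_neq_id; apply: automorphism_fix_ideal.
  have fixed y : J y /\ hermitian_or_skew sigma y -> T y = y.
    by move=> [Jy sy]; apply: contrapT => Ty; apply: nex; exists y.
  move=> x Jx; apply/eqP; rewrite -subr_eq0; apply/eqP/tf.
  rewrite mulr2n addrACA -TD -opprD doubleE TD.
  by rewrite (fixed _ (sumP x Jx)) (fixed _ (diffP x Jx)) subrr.
have central := commuting_hermitian_or_skew_central Jx sx Tx.
have centralJ y : J y -> center R y.
  move=> Jy; apply: center_half => //; rewrite doubleE.
  have [Jp sp] := sumP y Jy; have [Jm sm] := diffP y Jy.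
  by apply: centerD; apply: central.
move=> r; apply: (sigma_ideal_centralizer invol spr JI Jj j_neq0) => y Jy.
by rewrite /commutator (centralJ y) // subrr.
Qed.

End OnIdeal.
End Automorphism.

Theorem theorem1 (R : rngType) (sigma : R -> R) (U : set R) (T : R -> R)
    (tf : torsion2_free R)
    (invol : is_involution sigma)
    (spr : sigma_prime sigma)
    (lieU : is_sigma_square_closed_lie_ideal sigma U)
    (autT : is_ring_automorphism T)
    (T_neq_id : ~ (T =1 id))
    (centT : centralizing_on T U)
    (commT : forall u, U u -> T (sigma u) = sigma (T u)) :
  U `<=` center R.
Proof.
have [sU Usq] := lieU; have UL := sigma_lie_ideal sU.
have JI := ideal_core_sigma_ideal invol sU.
have JU x : ideal_core U x -> U x by case.
have [[j [Jj j_neq0]]|Jeq0] := EM (exists j, ideal_core U j /\ j <> 0).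
  move=> u _; apply: (commuting_automorphism_commutative tf invol spr autT JI
    Jj j_neq0) => // x /JU; first exact: commT.
  exact: (centralizing_commuting tf invol spr autT Usq).
(* With zero core, every $s \cdot 2[u,v] \cdot t$ vanishes. Semiprimeness is used twice so that
   $2[u,v]$ acquires factors on both sides. *)
apply: (commutative_lie_ideal_central invol spr tf UL) => u v Uu Uv.
apply: tf; rewrite mulr2n; apply: (sigma_prime_semiprime invol spr) => r.
have rcs0 s t :
    s ** (commutator u v + commutator u v) ** t = 0.
  apply: contrapT => rcs_neq0; apply: Jeq0; eexists; split; last exact: rcs_neq0.
  exact: ideal_core_double_commutator.
apply: (sigma_prime_semiprime invol spr) => s.
by rewrite rcs0 rmul0l.
Qed.
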